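(* For $n\ge1$ and $0\le c\le n-1$, we have $|M^{+c}_{3,n}|=c!\,(c+1)^{n-c}\,n!$, where $M^{+c}_{3,n}$ is defined in the context.
   Context: For $n\ge1$, $S_n$ is the set of permutations of $\{0,\dots,n-1\}$ in one-line notation. $S^3_n$ is the set of pairs $\Pi=(\pi^2,\pi^3)$ of elements of $S_n$; its elements are the columns $\Pi_j=(\pi^2_j,\pi^3_j)^T$, and the (sum) level of $\Pi_j$ is $\mathrm{lev}(\Pi_j)=\pi^2_j+\pi^3_j$. Let $\mathrm{lev}_{\max}(\Pi)=\max_j \mathrm{lev}(\Pi_j)$, $m_{3,n}=\min\{\mathrm{lev}_{\max}(\Pi):\Pi\in S^3_n\}$, and $M^{+c}_{3,n}=\{\Pi\in S^3_n: \mathrm{lev}_{\max}(\Pi)\le m_{3,n}+c\}$. *)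

(* Defs.v *)
From mathcomp Require Import all_boot all_fingroup.

Set Implicit Arguments.
Unset Strict Implicit.
Unset Printing Implicit Defensive.

(* The pair (pi^2, pi^3); [P.1 j] and [P.2 j] are the entries of column j. *)
Definition perm3 (n : nat) : finType := ('S_n * 'S_n)%type.

Definition lev (n : nat) (P : perm3 n) (j : 'I_n) : nat := P.1 j + P.2 j.

Definition lev_max (n : nat) (P : perm3 n) : nat := \max_(j < n) lev P j.

(* The pair (1, 1) of identities only witnesses that [perm3 n] is nonempty. *)
Definition min_lev_max (n : nat) : nat :=
  lev_max [arg min_(P < ((1, 1)%g : perm3 n)) lev_max P].

Definition M3 (n c : nat) : {set perm3 n} :=
  [set P : perm3 n | lev_max P <= min_lev_max n + c].

(* Main.v *)
(* The minimum is n - 1: the column whose first entry is n - 1 has at least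
   that level, and (id, reversal) attains it.  Relabelling the columns of
   (p, q) by p turns the condition into i + s i < n + c for s = p^-1 q, which
   leaves a factor n!.  These s are counted by deleting the entry n - 1 of
   s : 'S_n: its position may be any i <= c, and the deletion preserves the
   condition, since the entries before that position satisfy it trivially. *)
Require Import Defs.
From mathcomp Require Import all_boot all_fingroup.
From mathcomp Require Import zify.

Set Implicit Arguments.
Unset Strict Implicit.
Unset Printing Implicit Defensive.

Definition band_perm (n c : nat) : {set 'S_n} :=
  [set s : 'S_n | [forall i : 'I_n, i + s i < n + c]].

Lemma lift_perm_max_inj (n : nat) :
  injective (fun x : 'I_n.+1 * 'S_n => lift_perm x.1 ord_max x.2).
Proof.
move=> [i s] [j t] /= e.
have eij : i = j.
  (* The position of the maximal value is recoverable: the common permutation sends both [i] and [j]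
     to [ord_max]. *)
  by apply: (@perm_inj _ (lift_perm i ord_max s)); rewrite {2}e !lift_perm_id.
subst j; congr pair; apply/permP => k.
by apply: (@lift_inj _ ord_max); rewrite -!(lift_perm_lift i) e.
Qed.

Lemma lift_perm_max_bij (n : nat) :
  bijective (fun x : 'I_n.+1 * 'S_n => lift_perm x.1 ord_max x.2).
Proof.
apply: inj_card_bij; first exact: lift_perm_max_inj.
by rewrite card_prod !card_Sn card_ord factS.
Qed.

(** The new entry contributes [i + n < n.+1 + c], that is [i <= c]. Entries of [s] from index [i] on
    shift by one, exactly as the bound does; an earlier index [k] has [k < c] and [s k < n]. *)
Lemma band_perm_lift (n c : nat) (i : 'I_n.+1) (s : 'S_n) :
  (lift_perm i ord_max s \in band_perm n.+1 c) =
  (i <= c) && (s \in band_perm n c).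
Proof.
rewrite !inE; apply/forallP/andP => [h | [ic /forallP h] k].
  have ic : i <= c by have := h i; rewrite lift_perm_id /=; lia.
  split=> //; apply/forallP => k; have := h (lift i k).
  rewrite lift_perm_lift lift_max /= /bump.
  have := ltn_ord (s k); have := ltn_ord k.
  by case: leqP => /=; lia.
case: (unliftP i k) => [j ->|->]; last by rewrite lift_perm_id /=; lia.
rewrite lift_perm_lift lift_max /= /bump.
have := h j; have := ltn_ord (s j).
by case: leqP => /=; lia.
Qed.

Lemma card_ord_leq (n c : nat) : #|[set i : 'I_n.+1 | i <= c]| = (minn c n).+1.
Proof.
rewrite -sum1_card (eq_bigl (fun i : 'I_n.+1 => i <= minn c n)); last first.
  by move=> i; rewrite inE leq_min -(ltnS i n) ltn_ord andbT.
by rewrite (big_ord_narrow_leq (geq_minr c n)) sum1_card card_ord.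
Qed.

Lemma card_band_permS (n c : nat) :
  #|band_perm n.+1 c| = (minn c n).+1 * #|band_perm n c|.
Proof.
rewrite -card_ord_leq -cardsX.
rewrite -(on_card_preimset (onW_bij _ (lift_perm_max_bij n))).
by apply: eq_card => -[i s]; rewrite inE in_setX inE band_perm_lift.
Qed.

Lemma card_band_perm (n c : nat) :
  #|band_perm n c| = \prod_(i < n) (minn c i).+1.
Proof.
elim: n => [|n IHn]; last by rewrite card_band_permS big_ord_recr /= IHn mulnC.
(* The condition is vacuous on ['I_0], so the set is all of ['S_0]. *)
rewrite big_ord0 -[RHS]/(0`!) -card_Sn; apply: eq_card => s.
by rewrite !inE; apply/forallP => -[].
Qed.

(** The factors with [i < c] are [1, ..., c]; each of the other [n - c] equals [c + 1]. *)
Lemma prod_minn_succ (n c : nat) :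
  c <= n -> \prod_(i < n) (minn c i).+1 = c`! * (c + 1) ^ (n - c).
Proof.
elim: n => [|n IHn]; first by case: c => // _; rewrite big_ord0.
rewrite big_ord_recr /= leq_eqVlt ltnS => /predU1P[-> | cn].
  (* For [c = n.+1] the induction hypothesis does not apply, but every minimum is [i], leaving a
     plain factorial. *)
  rewrite subnn expn0 muln1 (minn_idPr (leqnSn n)) factS mulnC fact_prod.
  rewrite big_add1 /= big_mkord; congr (_ * _).
  by apply: eq_bigr => i _; congr S; apply/minn_idPr; have := ltn_ord i; lia.
by rewrite IHn // (minn_idPl cn) subSn // expnSr addn1 mulnA.
Qed.

Lemma lev_max_ge (n : nat) (P : perm3 n.+1) : n <= lev_max P.
Proof.
apply: leq_trans (leq_bigmax ((P.1)^-1%g ord_max)).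
by rewrite /lev permKV leq_addr.
Qed.

Lemma min_lev_maxS (n : nat) : min_lev_max n.+1 = n.
Proof.
rewrite /min_lev_max; case: arg_minnP => // P _ /(_ (1, perm rev_ord_inj)%g isT).
move=> le_rev; apply/eqP; rewrite eqn_leq lev_max_ge andbT.
apply: leq_trans le_rev _; apply/bigmax_leqP => i _.
by rewrite /lev perm1 permE /=; have := ltn_ord i; lia.
Qed.

(** Since [(p * q) j = q (p j)], column [j] is [(i, q i)] with [i = p j]; a level at most [n + c] is
    one below [n.+1 + c]. *)
Lemma mem_M3_mul (n c : nat) (p q : 'S_n.+1) :
  ((p, (p * q)%g) \in M3 n.+1 c) = (q \in band_perm n.+1 c).
Proof.
rewrite !inE min_lev_maxS; apply/bigmax_leqP/forallP => [h i | h i _].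
  by have := h ((p^-1)%g i) isT; rewrite /lev /= permM permKV; lia.
by have := h (p i); rewrite /lev /= permM; lia.
Qed.

Theorem theorem4p14 (n c : nat) (hn : 1 <= n) (hc : c <= n - 1) :
  #|M3 n c| = c`! * (c + 1) ^ (n - c) * n`!.
Proof.
case: n hn hc => // n _ hc.
rewrite -prod_minn_succ; last by lia.
rewrite -card_band_perm mulnC -card_Sn -cardsT -cardsX.
(* Under this bijection the preimage of [M3 n.+1 c] is the full group times [band_perm n.+1 c]. *)
have shear_bij : bijective (fun x : perm3 n.+1 => (x.1, (x.1 * x.2)%g) : perm3 n.+1).
  exists (fun x => (x.1, (x.1^-1 * x.2)%g)) => -[p q] /=.
    by rewrite mulKg.
  by rewrite mulKVg.
rewrite -(on_card_preimset (onW_bij _ shear_bij)).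
by apply: eq_card => -[p q]; rewrite [RHS]in_setX in_setT -(mem_M3_mul c p) [LHS]inE.
Qed.
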